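(* Let $p\ge 3$ be an odd prime and let $G=\langle x,y\rangle$ be a metabelian $p$-group of maximal class of order $|G|=p^m$, where $m\ge 3$. Suppose that the generators are selected such that $x\in G\setminus\chi_2(G)$ if $m\ge 4$, $y\in\chi_2(G)\setminus\gamma_2(G)$, and that the relations $$x^p=s_{m-1}^w,\qquad y^p\prod_{\ell=2}^p s_\ell^{\binom{p}{\ell}}=s_{m-1}^z$$ are satisfied with exponents $0\le w,z\le p-1$. Let the maximal normal subgroups of $G$ be ordered by $M_1=\langle y,\gamma_2(G)\rangle$ and $M_i=\langle xy^{i-2},\gamma_2(G)\rangle$ for $2\le i\le p+1$, and let $\mathrm{V}_i:G/\gamma_2(G)\to M_i/\gamma_2(M_i)$ be the transfer from $G$ to $M_i$ for $1\le i\le p+1$. Then for all $0\le j,\ell\le p-1$, $$\mathrm{V}_i(x^jy^\ell\gamma_2(G))=s_{m-1}^{wj+z\ell}\,\gamma_2(M_i)\qquad\text{for }1\le i\le p+1.$$ In explicit form, $$\mathrm{V}_1(x^jy^\ell\gamma_2(G))=\begin{cases}s_{m-1}^{wj+z\ell}\cdot 1,&\text{if }[\chi_2(G),\gamma_2(G)]=1,\ k=0,\ m\ge 3,\ p\ge 3,\\ 1\cdot\gamma_{m-1}(G),&\text{if }[\chi_2(G),\gamma_2(G)]=\gamma_{m-1}(G),\ k=1,\ m\ge 5,\ p\ge 3,\\ 1\cdot\gamma_{m-k}(G),&\text{if }[\chi_2(G),\gamma_2(G)]=\gamma_{m-k}(G),\ k\ge 2,\ m\ge 6,\ p\ge 5,\end{cases}$$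 and, for $2\le i\le p+1$, $$\mathrm{V}_i(x^jy^\ell\gamma_2(G))=\begin{cases}s_2^{wj+z\ell}\cdot 1,&\text{if }m=3,\\ 1\cdot\gamma_3(G),&\text{if }m\ge 4.\end{cases}$$
   Context: Conventions: $[a,b]=a^{-1}b^{-1}ab$, $a^b=b^{-1}ab$. The lower central series is $\gamma_1(G)=G$, $\gamma_j(G)=[\gamma_{j-1}(G),G]$ for $j\ge 2$. A $p$-group of order $p^m$ is of maximal class if its nilpotency class is $m-1$; then $G/\gamma_2(G)$ is of type $(p,p)$. Metabelian means that $\gamma_2(G)$ is abelian. $\chi_2(G)=\{g\in G\mid [g,u]\in\gamma_4(G)\text{ for all }u\in\gamma_2(G)\}$ is the two-step centraliser; it contains $\gamma_2(G)$ and equals $G$ if and only if $m=3$. The invariant $k=k(G)$ is defined by $[\chi_2(G),\gamma_2(G)]=\gamma_{m-k}(G)$, where $k=0$ for $m=3$, $0\le k\le m-4$ for $m\ge 4$, and $0\le k\le\min\{m-4,p-2\}$ for $m\ge p+1$. Commutators: $s_2=[y,x]$ and $s_j=[s_{j-1},x]$ for $j\ge 3$. The commutator groups of the maximal subgroups are $\gamma_2(M_1)=1$ if $k=0$, $\gamma_2(M_1)=\gamma_{m-k}(G)$ if $k\ge 1$, and $\gamma_2(M_i)=\gamma_3(G)$ for $2\le i\le p+1$. The transfer is the usual transfer homomorphism; here it is given by $g\gamma_2(G)\mapsto g^p\gamma_2(M_i)$ if $g\in G\setminus M_i$, and $g\gamma_2(G)\mapsto\prod_{r=0}^{p-1}g^{h^r}\gamma_2(M_i)$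 if $g\in M_i$, with any fixed $h\in G\setminus M_i$. *)

(* Defs.v *)
From mathcomp Require Import all_boot all_fingroup all_solvable.

Set Implicit Arguments.
Unset Strict Implicit.
Unset Printing Implicit Defensive.

Local Open Scope group_scope.

(* Conventions.  MathComp's [~ a, b] is a^-1 * b^-1 * a * b, a ^ b is          *)
(* b^-1 * a * b, and the lower central series 'L_n(G) starts with 'L_1(G) = G. *)

Definition maximal_class (gT : finGroupType) (p m : nat) (G : {group gT}) :=
  #|G| = (p ^ m)%N /\ nil_class G = m.-1.

Definition metabelian (gT : finGroupType) (G : {group gT}) :=
  abelian 'L_2(G).

Definition chi2 (gT : finGroupType) (G : {group gT}) : {set gT} :=
  [set g in G | [forall u in 'L_2(G), [~ g, u] \in 'L_4(G)]].

(* The k with [~: chi2 G, 'L_2(G)] = 'L_(m - k)(G), for G of maximal class and *)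
(* order p ^ m. It is unique because 'L_1(G), ..., 'L_m(G) are distinct; the   *)
(* default value m would mean that there is no such k < m.                     *)
Definition invariant_k (gT : finGroupType) (m : nat) (G : {group gT}) : nat :=
  find (fun k => [~: chi2 G, 'L_2(G)] == 'L_(m - k)(G)) (iota 0 m).

(* s_2 = [y, x] and s_j = [s_(j-1), x] for j >= 3; used for j >= 2 only. *)
Definition scomm (gT : finGroupType) (x y : gT) (j : nat) : gT :=
  iter (j - 2) (fun s => [~ s, x]) [~ y, x].

(* The subgroups M_1, ..., M_(p+1), used for 1 <= i <= p + 1 only. *)
Definition maxsub (gT : finGroupType) (G : {group gT}) (x y : gT) (i : nat) :
    {group gT} :=
  [group of <<(if i == 1%N then y else x * y ^+ (i - 2)) |: 'L_2(G)>>].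

Section AbelianizedTransfer.

Variables (gT : finGroupType) (G M : {group gT}).

Lemma norm_lcn2 : M \subset 'N('L_2(M)).
Proof. exact: lcn_norm. Qed.

Definition ab_proj := restrm_morphism norm_lcn2 (coset_morphism 'L_2(M)).

Lemma ab_proj_abelian : abelian (ab_proj @* M).
Proof.
rewrite morphim_restrm setIid; apply: sub_der1_abelian.
exact: subxx.
Qed.

(* The transfer G / 'L_2(G) -> M / 'L_2(M), namely the library's transfer of G *)
(* into M for the projection M -> M / 'L_2(M), evaluated at a representative   *)
(* (any one: see ab_transferE). It is meaningful when M \subset G.             *)
Definition ab_transfer (u : coset_of 'L_2(G)) : coset_of 'L_2(M) :=
  FiniteModule.fmval (transfer G ab_proj_abelian (repr u)).

Lemma ab_transferE (g : gT) : g \in G ->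
  ab_transfer (coset 'L_2(G) g)
  = FiniteModule.fmval (transfer G ab_proj_abelian g).
Proof.
have nLG : G \subset 'N('L_2(G)) by exact: lcn_norm.
move=> Gg; rewrite /ab_transfer val_coset ?(subsetP nLG) //.
case: repr_rcosetP => h Lh.
have Gh : h \in G by apply: (subsetP (lcn_sub 2 G)).
rewrite transferM // FiniteModule.fmvalA.
pose f := transfer_morphism G ab_proj_abelian.
have : f h \in f @* G^`(1) by rewrite mem_morphim.
have abf : abelian (f @* G) by apply/centsP=> a _ b _; apply: FiniteModule.fmod_addrC.
rewrite morphim_der // (derG1P abf) => /set1P /= ->.
exact: mul1g.
Qed.

End AbelianizedTransfer.

Arguments ab_transfer {gT} G M u.

(* Main.v *)
(* The transfer to a normal subgroup M of prime index p sends g outside M to   *)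
(* g^p, and g in M to the product of its conjugates by the powers of any h     *)
(* outside M. For M_1 this product is evaluated at y modulo 'L_2(M_1) with     *)
(* prod_(r < n) t_0 ^ (x ^ r) = prod_(l < n) t_l ^ 'C(n, l + 1) for commuting  *)
(* t_l such that t_l ^ x = t_l t_(l + 1): this turns it into the left hand     *)
(* side of the second relation. For i >= 2 one has 'L_2(M_i) = 'L_3(G), modulo *)
(* which G has class 2 and s_2 has order dividing p, and p divides 'C(p, 2).   *)
(*   [chi_2(G), 'L_2(G)] is normal and contained in 'L_4(G), hence a term      *)
(* 'L_j(G) of the lower central series, with j >= 4. For p = 3, commuting the  *)
(* second relation with y gives [s_2, y, x] = [s_2, y]^-3, and commuting it    *)
(* with x shows that cubing maps 'L_i(G) into 'L_(i + 2)(G) for i >= 2; so     *)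
(* 'L_(j + 1)(G) is contained in 'L_(j + 2)(G), which forces j >= m - 1.       *)

Require Import Defs.
From mathcomp Require Import all_boot all_fingroup all_solvable.

Set Implicit Arguments.
Unset Strict Implicit.
Unset Printing Implicit Defensive.

Local Open Scope group_scope.

(** * The transfer to a normal subgroup of prime index *)

(** The transfer is a homomorphism, so everything reduces to its values at x and y. As M_i has prime
    index, an element outside it permutes the p cosets in one cycle ([transfer_notin]), while an
    element inside fixes each of them ([transfer_in]). Outside M_i the value is a p-th power, read
    off from the relations. The two remaining cases, x in M_2 and y in M_1, are conjugate products,
    which [prod_conj_binomial] expands. This gives [maxsub_transfer_x], [maxsub_transfer_y] and the
    uniform formula [ab_transfer_maxsub].

    The explicit forms follow by identifying the derived subgroups of the M_i ([lcn2_maxsub1],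
    [maxsub_lcn3]): s_(m-1) lies in the last nontrivial term of the lower central series, hence is
    absorbed by every term 'L_i(G) with i < m.

    For the case distinction, [maxclass_normal_sub] shows that a normal subgroup inside 'L_2(G) is a
    term of the series; so [chi_2(G), 'L_2(G)] = 'L_j(G) for some j >= 4 ([chi2_comm_lcn]), which
    bounds k by m - 4. What remains is to exclude k >= 2 for p = 3 ([chi2_comm_lcn_p3]): the right
    hand side of the second relation is central, so commuting its left hand side with x and with y
    yields identities that force 'L_(j+1)(G) into 'L_(j+2)(G). *)

Lemma prod_conj_binomial (gT : finGroupType) (t : nat -> gT) (x : gT) :
    (forall j, t j ^ x = t j * t j.+1) -> (forall i j, commute (t i) (t j)) ->
  forall n, \prod_(0 <= r < n) t 0 ^ (x ^+ r)
            = \prod_(0 <= l < n) t l ^+ 'C(n, l.+1).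
Proof.
move=> tJ tC; elim=> [|n IHn]; first by rewrite !big_geq.
rewrite big_nat_recl // conjg1.
under eq_bigr => r _ do rewrite expgSr conjgM.
have cX i j a b: commute (t i ^+ a) (t j ^+ b) by apply: commuteX2.
(* Splitting off the factor r = 0 leaves the x-conjugate of the product for n; the step is then
   Pascal's rule. *)
rewrite -(big_morph (conjg^~ x) (fun u v => conjMg u v x) (conj1g x)) IHn.
rewrite (big_morph (conjg^~ x) (fun u v => conjMg u v x) (conj1g x)).
under eq_bigr => l _ do rewrite conjXg tJ expgMn //.
rewrite prodgM_commute; last by move=> i j _ _; apply: cX.
under [RHS]eq_bigr => l _ do rewrite binS expgD.
rewrite prodgM_commute; last by move=> i j _ _; apply: cX.
rewrite (big_nat_recr n) //= bin_small // mulg1.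
rewrite big_nat_recl //= bin0 expg1 !mulgA; congr (_ * _).
by apply: commute_prod => i _; rewrite -[t 0]expg1; apply: cX.
Qed.

Section PrimeIndex.

Variables (gT : finGroupType) (G M : {group gT}) (p : nat).
Hypotheses (nMG : M <| G) (p_pr : prime p) (iMG : #|G : M| = p).

Lemma prime_index_mem_expg g n :
  g \in G -> g \notin M -> (g ^+ n \in M) = (p %| n).
Proof.
move=> Gg M'g; have Ng := subsetP (normal_norm nMG) g Gg.
have oMg: #[coset M g] = p.
  apply/(prime_nt_dvdP p_pr); last first.
    by rewrite -iMG -card_quotient ?normal_norm // order_dvdG ?mem_quotient.
  by rewrite order_eq1; apply: contra M'g => /eqP/coset_idr->.
rewrite -[in RHS]oMg order_dvdn -morphX //.
apply/idP/eqP => [Mgn|]; first exact: coset_id.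
by apply: coset_idr; rewrite groupX.
Qed.

Lemma prime_index_mulg_cycle g : g \in G -> g \notin M -> M * <[g]> = G.
Proof.
move=> Gg M'g; have [sMG _] := andP nMG.
have ngM: <[g]> \subset 'N(M) by rewrite cycle_subG (subsetP (normal_norm nMG)).
have sJG: M <*> <[g]> \subset G by rewrite join_subG sMG cycle_subG.
rewrite -norm_joinEr //; apply/eqP; rewrite eqEsubset sJG -indexg_eq1.
have: #|G : M <*> <[g]>| %| p by rewrite -iMG indexgS ?joing_subl.
case/primeP: p_pr => _ dvp /dvp/orP[// | /eqP iJ].
case/negP: M'g; suff ->: (M :=: M <*> <[g]>)
  by rewrite mem_gen // inE cycle_id orbT.
apply/eqP; rewrite eqEcard joing_subl /=.
by rewrite -(leq_pmul2r (prime_gt0 p_pr)) -{1}iJ -iMG !Lagrange.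
Qed.

Let N := 'L_2(M).

Lemma transfer_notin g : g \in G -> g \notin M ->
  FiniteModule.fmval (transfer G (ab_proj_abelian M) g) = coset N (g ^+ p).
Proof.
move=> Gg M'g; have [sMG _] := andP nMG.
(* The powers of g form a single orbit on the cosets, of length p, because M<g> = G. *)
have defP: rcosets M G :* <[g]> = [set (G : {set gT})].
  apply/setP=> X; rewrite inE; apply/imset2P/eqP
    => [[_ _ /rcosetsP[u Gu ->] /set1P-> ->]|->].
    rewrite norm_rlcoset ?(subsetP (normal_norm nMG)) // -mulgA.
    by rewrite prime_index_mulg_cycle // lcoset_id.
  exists (M : {set gT}) <[g]>; rewrite ?set11 ?prime_index_mulg_cycle //.
  by apply/rcosetsP; exists 1; rewrite ?mulg1.
have trX: is_transversal [set 1] (rcosets M G :* <[g]>) G.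
  rewrite defP /is_transversal; apply/and3P; split.
  - by rewrite -defP rcosets_cycle_partition.
  - by rewrite sub1set.
  - by apply/forall_inP=> _ /set1P->; rewrite (setIidPl _) ?cards1 // sub1set.
rewrite (transfer_cycle_expansion sMG _ Gg trX) big_set1.
have := sum_index_rcosets_cycle sMG Gg trX; rewrite big_set1 iMG => ->.
rewrite invg1 conjg1 /restrm /= FiniteModule.fmodK //.
by rewrite mem_morphim ?prime_index_mem_expg.
Qed.

Lemma transfer_in g h : g \in M -> h \in G -> h \notin M ->
  FiniteModule.fmval (transfer G (ab_proj_abelian M) g)
  = coset N (\prod_(0 <= r < p) g ^ (h ^+ r)).
Proof.
move=> Mg Gh M'h; have [sMG nMG'] := andP nMG.
have p_gt0 := prime_gt0 p_pr.
have Gg := subsetP sMG g Mg.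
(* Negative powers, so that the contribution of the r-th coset is g ^ (h ^+ r) and not its conjugate
   by the inverse. *)
pose f (r : 'I_p) := M :* h ^- r.
have inj_f: injective f.
  move=> r s /rcoset_eqP; rewrite mem_rcoset invgK => Mrs.
  apply: val_inj; apply/eqP.
  wlog le_rs: r s Mrs / (r <= s)%N.
    move=> IH; case/orP: (leq_total r s) => [/IH-> // | /IH].
    by rewrite eq_sym; apply; rewrite -groupV invMg invgK.
  have: h ^+ (s - r) \in M.
    by move: Mrs; rewrite -{1}(subnKC le_rs) expgD mulKg.
  rewrite prime_index_mem_expg // => /dvdnP[[|k] E]; last first.
    have: (s - r < p)%N by rewrite (leq_ltn_trans (leq_subr r s)).
    by rewrite E ltnNge mulSn leq_addr.
  by rewrite eqn_leq le_rs -subn_eq0 E.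
have defG: rcosets M G = [set f r | r : 'I_p].
  apply/esym/eqP; rewrite eqEcard
    (card_imset _ inj_f) card_ord -[X in _ && X]/(#|G : M| <= p)%N iMG leqnn andbT.
  apply/subsetP=> _ /imsetP[r _ ->]; rewrite /f -rcosetE imset_f //.
  by rewrite groupV groupX.
have NM: M \subset 'N(N) by exact: lcn_norm.
rewrite /transfer defG big_imset /=; last by move=> ? ? _ _; apply: inj_f.
have MJ r: g ^ (h ^+ r) \in M by rewrite memJ_norm // (subsetP nMG') ?groupX.
rewrite FiniteModule.fmval_sum big_mkord.
have -> : coset N (\prod_(i < p) g ^ h ^+ i) = \prod_(i < p) coset N
  (g ^ h ^+ i).
  rewrite -[LHS]/(coset_morphism N _) morph_prod //.
  by move=> i _; rewrite (subsetP NM).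
apply: eq_big => // i _.
have -> : f i :* g = f i.
  rewrite -[RHS](congr1 (fun A => A :* h ^- i) (rcoset_id (MJ i))).
  by rewrite /f -!rcosetM conjgE -!mulgA mulgV mulg1.
(* The representative chosen by [transfer] differs from h^-r by some a in M; conjugation by a
   disappears in the abelian quotient. *)
rewrite /f; case: repr_rcosetP => a Ma.
have -> : a * h ^- i * g * (a * h ^- i)^-1 = (g ^ (h ^+ i)) ^ a^-1.
  by rewrite !conjgE !invMg !invgK !mulgA.
rewrite /restrm /= FiniteModule.fmodK; last first.
  by apply: (mem_morphim (ab_proj M)); rewrite groupJ ?groupV.
have /centsP cM: abelian (M / N) by apply: sub_der1_abelian.
have NMJ r := subsetP NM _ (MJ r).
rewrite [LHS](morphJ (coset_morphism N)) ?groupV ?(subsetP NM a) //= conjgE.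
by rewrite (cM (coset N (g ^ h ^+ i))) ?mulKg ?mem_quotient ?groupV ?MJ.
Qed.
End PrimeIndex.

(** * Commutators and centralisers modulo a normal subgroup *)

Lemma commg_gen_sub (gT : finGroupType) (A S : {set gT}) (N : {group gT}) :
    A \subset 'N(N) -> S \subset 'N(N) ->
    (forall a s, a \in A -> s \in S -> [~ a, s] \in N) ->
  [~: <<A>>, <<S>>] \subset N.
Proof.
move=> nNA nNS cAS; rewrite -quotient_cents2 ?gen_subG //.
rewrite !quotient_gen // gen_subG /= cent_gen.
by rewrite quotient_cents2r // gen_subG;
  apply/subsetP=> _ /imset2P[a s Aa Ss ->]; apply: cAS.
Qed.

(** G acts on the abelian group 'L_2(G) through the abelian quotient G / 'L_2(G). Written
    additively, the two sides are the images of a under (g - 1)(h - 1) and (h - 1)(g - 1). *)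
Lemma commg_AC (gT : finGroupType) (G : {group gT}) (a g h : gT) :
    abelian 'L_2(G) -> a \in 'L_2(G) -> g \in G -> h \in G ->
  [~ a, g, h] = [~ a, h, g].
Proof.
move=> /centsP cA Aa Gg Gh.
have AJ b u : b \in 'L_2(G) -> u \in G -> b ^ u \in 'L_2(G).
  by move=> Ab Gu; rewrite memJ_norm // (subsetP (lcn_norm 2 G)).
have aghE : a ^ (g * h) = a ^ (h * g).
  rewrite (commgC g) conjgM; apply/conjg_fixP/commgP/cA.
    by rewrite AJ ?groupM.
  exact: mem_commg.
have E (b u : gT) : [~ b, u] = b^-1 * b ^ u by rewrite commgEl.
have Ag := AJ a g Aa Gg; have Ah := AJ a h Aa Gh.
rewrite !E !(conjMg a^-1) !conjVg -!conjgM -aghE.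
move: (a ^ g) (a ^ h) (a ^ (g * h)) Ag Ah => u v b Au Av.
rewrite !invMg !invgK !mulgA; congr (_ * _).
rewrite -mulgA (cA _ _ (a * _)) ?groupM ?groupV //.
by rewrite (cA a _ v^-1) ?groupV.
Qed.

(** The centraliser in G of M modulo D. As the preimage of a centraliser it is a group by inference,
    so commutator conditions need checking on generators only. Instances are chi_2(G) and, for M =
    G, the preimage of a centre. *)
Definition cent_mod (gT : finGroupType) (G M D : {group gT}) :=
  G :&: coset D @*^-1 'C(M / D).

Section CentMod.

Variables (gT : finGroupType) (G M D : {group gT}).
Hypotheses (nDG : D <| G) (nMG : M <| G).

Canonical cent_mod_group := [group of cent_mod G M D].

Lemma cent_modP g :
  reflect (g \in G /\ forall u, u \in M -> [~ g, u] \in D)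
    (g \in cent_mod G M D).
Proof.
have NG := normal_norm nDG; have NM := subset_trans (normal_sub nMG) NG.
rewrite inE; apply: (iffP andP) => [[Gg]|[Gg]].
  case/morphpreP=> Ng cg; split=> // u Mu.
  have Nu := subsetP NM u Mu; apply: coset_idr; first exact: groupR.
  by rewrite morphR //; apply/eqP/commgP/(centP cg)/mem_quotient.
move=> cg; split=> //; rewrite mem_morphpre ?(subsetP NG) //.
apply/centP=> _ /morphimP[u Nu Mu ->]; apply/commgP.
have Ng := subsetP NG g Gg; apply/eqP; rewrite -(morphR (coset_morphism D)) //=.
by rewrite coset_id ?cg.
Qed.

Lemma cent_mod_normal : cent_mod G M D <| G.
Proof.
apply/andP; split; first exact: subsetIl.
apply/subsetP=> h Gh; rewrite inE;
  apply/subsetP=> _ /imsetP[g /cent_modP[Gg cg] ->].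
apply/cent_modP; split=> [|u Mu]; first exact: groupJ.
rewrite -[u](conjgKV h) -conjRg memJ_norm ?cg //.
  by rewrite memJ_norm ?groupV // (subsetP (normal_norm nMG)).
by rewrite (subsetP (normal_norm nDG)).
Qed.

End CentMod.

Lemma chi2E (gT : finGroupType) (G : {group gT}) :
  chi2 G = cent_mod G 'L_2(G)%G 'L_4(G)%G.
Proof.
apply/setP=> g; rewrite inE; apply/andP/(cent_modP (lcn_normal _ _)
  (lcn_normal _ _)).
  by case=> Gg /forall_inP.
by case=> Gg ?; split=> //; apply/forall_inP.
Qed.

Lemma chi2_group_set (gT : finGroupType) (G : {group gT}) : group_set (chi2 G).
Proof. by rewrite chi2E; exact: groupP. Qed.

Canonical chi2_group (gT : finGroupType) (G : {group gT}) :=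
  Group (chi2_group_set G).

Section TwoGenerators.

Variables (gT : finGroupType) (G : {group gT}) (x y : gT).
Hypothesis genG : <<[set x; y]>> = G.

Lemma gen2_l : x \in G. Proof. by rewrite -genG mem_gen ?set21. Qed.
Lemma gen2_r : y \in G. Proof. by rewrite -genG mem_gen ?set22. Qed.

Lemma lcn2_sub_gen2 (N : {group gT}) : N <| G -> [~ y, x] \in N
  -> 'L_2(G) \subset N.
Proof.
move=> nNG Nyx; have NN := normal_norm nNG.
have sN: [set x; y] \subset 'N(N)
  by rewrite (subset_trans _ NN) // -genG subset_gen.
rewrite lcn2 derg1 -genG commg_gen_sub //= => a b.
have Nxy: [~ x, y] \in N by rewrite -invg_comm groupV.
by rewrite !inE => /orP[]/eqP-> /orP[]/eqP->; rewrite ?commgg ?group1.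
Qed.

Lemma cent_mod_gen2 (N : {group gT}) u : N <| G -> u \in G ->
  [~ u, x] \in N -> [~ u, y] \in N -> u \in cent_mod G G N.
Proof.
move=> nNG Gu Nx Ny; apply/(cent_modP nNG (normal_refl G)); split=> // v Gv.
have NN := normal_norm nNG.
have sN: [set x; y] \subset 'N(N)
  by rewrite (subset_trans _ NN) // -genG subset_gen.
suff /subsetP: [~: <<[set u]>>, <<[set x; y]>>] \subset N.
  by apply; rewrite genG mem_commg // mem_gen ?set11.
apply: commg_gen_sub => //; first by rewrite sub1set (subsetP NN).
by move=> a b /set1P-> /set2P[]->.
Qed.

End TwoGenerators.

(** * p-groups of maximal class *)

Section MaximalClass.

Variables (gT : finGroupType) (G : {group gT}) (p m : nat).
Hypotheses (p_pr : prime p) (m_ge3 : 3 <= m) (maxG : maximal_class p m G).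

Let oG : #|G| = (p ^ m)%N := proj1 maxG.
Let clG : nil_class G = m.-1 := proj2 maxG.

Lemma maxclass_pgroup : p.-group G.
Proof. by rewrite /pgroup oG pnatX pnat_id ?orbT. Qed.

Let nilG : nilpotent G := pgroup_nil maxclass_pgroup.

Lemma maxclass_lcn_eq1 j : m <= j -> 'L_j(G) = 1.
Proof.
case: j => [|j] lemj; first by move: m_ge3; rewrite leqn0 in lemj;
  rewrite (eqP lemj).
by apply/(lcn_nil_classP j nilG);
  rewrite clG -ltnS prednK // (leq_trans _ m_ge3).
Qed.

Lemma maxclass_lcn_neq1 j : j < m -> 'L_j(G) != 1.
Proof.
move=> ltjm; have m1 : m.-1 = m.-2.+1 by case: m m_ge3 => [|[]].
have: 'L_m.-1(G) != 1.
  rewrite m1; apply/eqP => /(lcn_nil_classP m.-2 nilG); rewrite clG.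
  by rewrite {1}m1 ltnn.
apply: contra => /eqP Lj1; rewrite -subG1 -Lj1 lcn_sub_leq // -ltnS prednK //.
exact: leq_trans m_ge3.
Qed.

Lemma maxclass_lcn_proper j : 1 <= j < m -> 'L_j.+1(G) \proper 'L_j(G).
Proof.
case: j => // j /andP[_ ltjm]; rewrite lcnSn.
by rewrite (nil_comm_properl nilG) ?lcn_sub ?maxclass_lcn_neq1
  // subsetI subxx lcn_norm.
Qed.

Lemma maxclass_not_cyclic : ~~ cyclic (G / 'L_2(G)).
Proof.
apply/negP => /(cyclic_nilpotent_quo_der1_cyclic nilG)/cyclic_abelian.
by rewrite -nil_class1 clG; case: m m_ge3 => [|[|[]]].
Qed.

Lemma proper_logn_card (H K : {group gT}) :
  K \subset G -> H \proper K -> logn p #|H| < logn p #|K|.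
Proof.
move=> sKG /properP[sHK [u Ku H'u]].
have pK := pgroupS sKG maxclass_pgroup; have pH := pgroupS sHK pK.
rewrite -(ltn_exp2l _ _ (prime_gt1 p_pr)) -!card_pgroup // proper_card //.
by apply/properP; split=> //; exists u.
Qed.

(** The series drops strictly down to 'L_m(G) = 1, which bounds the orders from below. From above, G
    / 'L_2(G) is not cyclic, so it has order at least p^2, and then too few factors p are left for
    any step to drop by more than one. *)
Lemma maxclass_logn_lcn j : 2 <= j <= m -> logn p #|'L_j(G)| = (m - j)%N.
Proof.
have stepL i : 1 <= i < m -> logn p #|'L_i.+1(G)| < logn p #|'L_i(G)|.
  move=> ltim; apply: (@proper_logn_card 'L_i.+1(G)%G 'L_i(G)%G).
      exact: lcn_sub.
    exact: maxclass_lcn_proper.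
have geL i : 1 <= i <= m -> m - i <= logn p #|'L_i(G)|.
  case/andP=> i_gt0 leim; rewrite -{2}[i](subKn leim).
  have: m - i < m by rewrite ltn_subrL i_gt0 (leq_trans _ m_ge3).
  elim: (m - i)%N => // k IHk ltkm; have {}IHk := IHk (ltnW ltkm).
  have Ek: (m - k = (m - k.+1).+1)%N by rewrite -subSn ?(ltnW ltkm).
  apply: leq_ltn_trans IHk _; rewrite Ek stepL // subn_gt0 ltkm.
  by rewrite ltn_subrL (leq_trans _ m_ge3).
have leL2: logn p #|'L_2(G)| <= m - 2.
  have: 2 <= logn p #|G / 'L_2(G)|.
    have pGL: p.-group (G / 'L_2(G)) := quotient_pgroup _ maxclass_pgroup.
    have := card_pgroup pGL; have := maxclass_not_cyclic.
    case: (logn p _) => [|[|//]] ncG oGL; case/negP: ncG.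
      by rewrite (card1_trivg oGL) cyclic1.
    by rewrite prime_cyclic // oGL.
  rewrite card_quotient ?lcn_norm // -divgS ?lcn_sub // => le2.
  have := Lagrange (lcn_sub 2 G);
    rewrite -divgS ?lcn_sub // => /(congr1 (logn p)).
  rewrite lognM ?cardG_gt0 // ?divn_gt0 ?subset_leq_card ?lcn_sub ?cardG_gt0 //.
  rewrite oG pfactorK // => <-.
  by rewrite -addnBA ?leq_addr -?oG.
have leL k: k.+2 <= m -> logn p #|'L_k.+2(G)| <= m - k.+2.
  elim: k => // k IHk ltkm; rewrite subnS -ltnS prednK ?subn_gt0 //.
  by rewrite (leq_trans (stepL _ _)) ?IHk ?(ltnW ltkm).
case/andP=> j_ge2 lejm; apply/eqP;
  rewrite eqn_leq geL ?lejm ?(ltnW j_ge2) // andbT.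
by case: j j_ge2 lejm => [|[|k]] // _ /leL.
Qed.

Lemma maxclass_card_lcn j : 2 <= j <= m -> #|'L_j(G)| = (p ^ (m - j))%N.
Proof.
move=> j2m; rewrite -maxclass_logn_lcn //.
by rewrite -card_pgroup // (pgroupS (lcn_sub _ _) maxclass_pgroup).
Qed.

Lemma maxclass_index_lcn j : 2 <= j < m -> #|'L_j(G) : 'L_j.+1(G)| = p.
Proof.
case/andP=> j2 jm; rewrite -divgS ?lcn_subS // !maxclass_card_lcn ?j2 ?(leqW j2)
  ?(ltnW jm) //.
by rewrite -expnB ?prime_gt0 ?leq_sub2l // subnS -subn1 subKn // subn_gt0.
Qed.

Lemma maxclass_lcn_expg j u : 2 <= j -> u \in 'L_j(G) -> u ^+ p \in 'L_j.+1(G).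
Proof.
move=> j2 Lu; case: (ltnP j m) => [jm | lemj]; last first.
  by move: Lu; rewrite maxclass_lcn_eq1 // => /set1P->; rewrite expg1n group1.
have NL := subsetP (normal_norm (lcn_normalS j G)) u Lu.
apply: coset_idr; first by rewrite groupX.
rewrite morphX // -(maxclass_index_lcn (j := j)) ?j2 // -card_quotient
  ?normal_norm ?lcn_normalS //.
by apply: expg_cardG; rewrite mem_quotient.
Qed.

Lemma maxclass_card_quo_lcn2 : #|G : 'L_2(G)| = (p ^ 2)%N.
Proof.
rewrite -divgS ?lcn_sub // oG maxclass_card_lcn ?leqnn ?(ltnW m_ge3) //.
by rewrite -expnB ?prime_gt0 ?leq_subr // subKn ?(ltnW m_ge3).
Qed.

(** The factor 'L_j / 'L_(j+1) has order p, so B covers it and 'L_j = 'L_(j+1) B. In the nilpotent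
    group G / B the image of 'L_j then equals its own commutator with G / B, hence is trivial. *)
Lemma maxclass_normal_sub (B : {group gT}) j : B <| G -> 2 <= j < m ->
  B \subset 'L_j(G) -> ~~ (B \subset 'L_j.+1(G)) -> B :=: 'L_j(G).
Proof.
move=> nBG j2m sBL sBL'; have [sBG NB] := andP nBG.
have nLj i : 'L_i(G) \subset 'N(B) := subset_trans (lcn_sub i G) NB.
have defL: 'L_j.+1(G) * B = 'L_j(G).
  have nB: B \subset 'N('L_j.+1(G)) := subset_trans sBG (lcn_norm _ _).
  apply/eqP; rewrite -norm_joinEr
    // eqEsubset join_subG lcn_subS sBL /= -indexg_eq1.
  have: #|'L_j(G) : 'L_j.+1(G) <*> B| %| p.
    by rewrite -(maxclass_index_lcn j2m) indexgS ?joing_subl.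
  case/primeP: p_pr => _ dvp /dvp/orP[// | /eqP iJ].
  case/negP: sBL'; apply: subset_trans (joing_subr 'L_j.+1(G) B) _.
  rewrite -indexg_eq1 -(eqn_pmul2l (prime_gt0 p_pr)) muln1 -{1}iJ.
  by rewrite Lagrange_index ?maxclass_index_lcn ?joing_subl
    // join_subG lcn_subS.
apply/eqP; rewrite eqEsubset sBL -quotient_sub1 //.
have nilGB: nilpotent (G / B) := quotient_nil B nilG.
apply: contraT => Lj1.
have: [~: 'L_j(G) / B, G / B] \proper 'L_j(G) / B.
  rewrite (nil_comm_properl nilGB) ?quotientS ?lcn_sub -?subG1 //.
  by rewrite subsetI subxx quotient_norms ?lcn_norm.
rewrite -quotientR // properE => /andP[_ /negP[]].
rewrite -{1}defL quotientMidr; apply: quotientS; case: (j) j2m => // i _.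
Qed.

End MaximalClass.

(** * Metabelian p-groups of maximal class *)

Section MetabelianMaximalClass.

Variables (gT : finGroupType) (G : {group gT}) (p m : nat) (x y : gT).
Hypotheses (p_pr : prime p) (m_ge3 : 3 <= m) (maxG : maximal_class p m G).
Hypotheses (metaG : metabelian G) (genG : <<[set x; y]>> = G).
Hypotheses (xP : 4 <= m -> x \in G :\: chi2 G) (yP : y \in chi2 G :\: 'L_2(G)).

Let Gx : x \in G := gen2_l genG.
Let Gy : y \in G := gen2_r genG.
Let sAG : 'L_2(G) \subset G := lcn_sub 2 G.
Let nL j : G \subset 'N('L_j(G)) := lcn_norm j G.
Let y_chi2 : y \in chi2 G. Proof. by case/setDP: yP. Qed.
Let cA a b (Aa : a \in 'L_2(G)) (Ab : b \in 'L_2(G)) : commute a b :=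
  centsP metaG a Aa b Ab.

Local Notation s := (scomm x y).
Local Notation M := (maxsub G x y).

Lemma scommS j : s j.+3 = [~ s j.+2, x].
Proof. by rewrite /scomm !subSS !subn0. Qed.

Lemma mem_commg_lcn j u g : u \in 'L_j.+1(G) -> g \in G
  -> [~ u, g] \in 'L_j.+2(G).
Proof. by move=> Lu Gg; rewrite lcnSn mem_commg. Qed.

Lemma scomm_lcn j : 2 <= j -> s j \in 'L_j(G).
Proof.
case: j => [|[|j]] // _; elim: j => [|j IHj]; first by rewrite mem_commg.
by rewrite scommS mem_commg_lcn.
Qed.

Lemma lcn_last_central u g : u \in 'L_m.-1(G) -> g \in G -> [~ u, g] = 1.
Proof.
have -> : m.-1 = m.-2.+1 by case: m m_ge3 => [|[]].
move=> Lu Gg; have := mem_commg_lcn Lu Gg.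
by rewrite (maxclass_lcn_eq1 p_pr m_ge3 maxG) => [/set1P|];
  case: m m_ge3 => [|[]].
Qed.

(** * The maximal subgroups and their derived subgroups *)

Lemma gen_lcn2_not_full g : g \in G -> ~~ (G \subset <<g |: 'L_2(G)>>).
Proof.
move=> Gg; apply: contra (maxclass_not_cyclic p_pr m_ge3 maxG) => sGg.
have Ng := subsetP (nL 2) g Gg.
apply: cyclicS (cycle_cyclic (coset 'L_2(G) g)).
apply: subset_trans (quotientS _ sGg) _.
rewrite quotient_gen ?subUset ?sub1set ?Ng ?normG // gen_subG.
apply/subsetP=> _ /morphimP[u _ /setU1P[->|Au] ->]; first exact: cycle_id.
by rewrite /= coset_id.
Qed.

Lemma gen_lcn2_normal g : g \in G -> <<g |: 'L_2(G)>> <| G.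
Proof.
move=> Gg; apply: sub_der1_normal.
  by rewrite -lcn2 (subset_trans _ (subset_gen _)) // subsetUr.
by rewrite gen_subG subUset sub1set Gg.
Qed.

Lemma gen_lcn2_index g : g \in G -> g \notin 'L_2(G)
  -> #|G : <<g |: 'L_2(G)>>| = p.
Proof.
move=> Gg A'g; set H := [group of <<g |: 'L_2(G)>>].
have sHG : H \subset G := normal_sub (gen_lcn2_normal Gg).
have sAH : 'L_2(G) \subset H by rewrite (subset_trans _ (subset_gen _))
  // subsetUr.
have := Lagrange_index sHG sAH;
  rewrite (maxclass_card_quo_lcn2 p_pr m_ge3 maxG) => iE.
have: #|G : H| %| p ^ 2 by rewrite -iE dvdn_mulr.
case/(dvdn_pfactor _ _ p_pr) => [[|[|[|//]]] _ iH].
- by case/negP: (gen_lcn2_not_full Gg);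
    rewrite -indexg_eq1 -[X in #|_ : X|]/(gval H) iH.
- exact: iH.
case/negP: A'g; have: H \subset 'L_2(G).
  by rewrite -indexg_eq1 -(eqn_pmul2l (indexg_gt0 G H)) iE iH muln1.
by move/subsetP; apply; rewrite mem_gen // setU11.
Qed.

Lemma maxsub_gen_in i : (if i == 1%N then y else x * y ^+ (i - 2)) \in G.
Proof. by case: ifP => // _; rewrite groupM ?groupX. Qed.

Lemma maxsub_normal i : M i <| G.
Proof. exact: gen_lcn2_normal (maxsub_gen_in i). Qed.

Lemma sub_lcn2_maxsub i : 'L_2(G) \subset M i.
Proof. by rewrite (subset_trans _ (subset_gen _)) // subsetUr. Qed.

Lemma maxsub_gen i : (if i == 1%N then y else x * y ^+ (i - 2)) \in M i.
Proof. by rewrite mem_gen // setU11. Qed.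

Lemma maxsub_not_both i : x \in M i -> y \in M i -> False.
Proof.
move=> Mx My; case/negP: (gen_lcn2_not_full (maxsub_gen_in i)).
rewrite -{1}genG gen_subG; apply/subsetP=> u /set2P[]->;
  [exact: Mx | exact: My].
Qed.

Lemma maxsub_index i : #|G : M i| = p.
Proof.
apply: gen_lcn2_index (maxsub_gen_in i) _.
case: ifP => [_ | i_neq1]; first by case/setDP: yP.
apply/negP=> Axy; have My : y \in M 1%N := maxsub_gen 1%N.
apply: (@maxsub_not_both 1%N) (My).
by rewrite -(mulgK (y ^+ (i - 2)) x) groupM ?groupV ?groupX // (subsetP
  (sub_lcn2_maxsub 1%N)).
Qed.

Lemma x_notin_maxsub1 : x \notin M 1%N.
Proof. by apply/negP=> Mx; apply: maxsub_not_both Mx (maxsub_gen 1%N). Qed.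

Lemma y_notin_maxsub i : 2 <= i -> y \notin M i.
Proof.
move=> i2; apply/negP=> My; have := maxsub_gen i; rewrite gtn_eqF // => Mxy.
apply: (maxsub_not_both _ My).
by move: Mxy; rewrite groupMr ?groupX.
Qed.

Lemma x_in_maxsub2 : x \in M 2.
Proof. by have := maxsub_gen 2; rewrite subnn expg0 mulg1. Qed.

Lemma x_notin_maxsub i : 3 <= i <= p.+1 -> x \notin M i.
Proof.
case/andP=> i3 ip; apply/negP=> Mx.
(* Since 0 < i - 2 < p and y is outside M_i, this power of y cannot lie in M_i. *)
have: y ^+ (i - 2) \in M i.
  by have := maxsub_gen i; rewrite gtn_eqF ?(ltnW i3) // groupMl.
rewrite (prime_index_mem_expg (maxsub_normal i) p_pr (maxsub_index i))
  ?y_notin_maxsub ?(ltnW i3) //.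
move/dvdn_leq; rewrite subn_gt0 => /(_ i3);
  rewrite leqNgt ltn_subLR ?(ltnW i3) //.
by rewrite !addSn add0n ltnS ip.
Qed.

Lemma lcn2_gen_sub g (N : {group gT}) : N <| G -> g \in G ->
  (forall a, a \in 'L_2(G) -> [~ g, a] \in N)
    -> 'L_2(<<g |: 'L_2(G)>>) \subset N.
Proof.
move=> /andP[_ NN] Gg Ng.
have sN : g |: 'L_2(G) \subset 'N(N).
  by rewrite subUset sub1set (subsetP NN) // (subset_trans sAG).
apply: commg_gen_sub => // a b /setU1P[->|Aa] /setU1P[->|Ab].
- by rewrite commgg group1.
- exact: Ng.
- by rewrite -invg_comm groupV Ng.
by have /commgP/eqP-> := cA Aa Ab; rewrite group1.
Qed.

Lemma chi2_normal : chi2 G <| G.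
Proof. by rewrite chi2E cent_mod_normal ?lcn_normal. Qed.

Lemma chi2_comm u g : u \in 'L_2(G) -> g \in chi2 G -> [~ u, g] \in 'L_4(G).
Proof.
rewrite inE => Au /andP[_ /forall_inP/(_ u Au)].
by move=> cgu; rewrite -invg_comm groupV.
Qed.

Lemma sub_lcn2_chi2 : 'L_2(G) \subset chi2 G.
Proof.
apply/subsetP=> a Aa; rewrite inE (subsetP sAG) //; apply/forall_inP=> b Ab.
by have /commgP/eqP-> := cA Aa Ab; rewrite group1.
Qed.

(** chi_2(G) contains the maximal subgroup M_1 and omits x. *)
Lemma chi2_maxsub1 : 4 <= m -> chi2 G = M 1%N.
Proof.
move=> m4; have maxM : maximal (M 1%N) G.
  by apply: p_index_maximal (normal_sub (maxsub_normal 1%N)) _;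
    rewrite maxsub_index.
have /maxgroupP[_ /(_ (chi2_group G)) maxC] := maxM; apply: maxC.
  rewrite properE normal_sub ?chi2_normal //=;
    apply/negP=> /subsetP/(_ x Gx) Cx.
  by have /setDP[_ /negP[]] := xP m4.
by rewrite gen_subG subUset sub1set y_chi2 sub_lcn2_chi2.
Qed.

Lemma lcn2_maxsub1 : 'L_2(M 1%N) = [~: chi2 G, 'L_2(G)].
Proof.
have M1g : y \in M 1%N := maxsub_gen 1%N.
have sM := normal_sub (maxsub_normal 1%N).
have -> : 'L_2(M 1%N) = [~: M 1%N, 'L_2(G)].
  apply/eqP; rewrite eqEsubset andbC.
  rewrite (commgS (M 1%N) (sub_lcn2_maxsub 1%N)) /=.
  apply: lcn2_gen_sub => // [|a Aa]; last by rewrite mem_commg.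
  apply/andP; split; [exact: comm_subG | apply: normsR;
    [exact: normal_norm (maxsub_normal 1%N) | exact: nL]].
have [m4 | m_le3] := leqP 4 m; first by rewrite chi2_maxsub1.
have L3 : 'L_3(G) = 1 by apply: (maxclass_lcn_eq1 p_pr m_ge3 maxG).
have tr (H : {set gT}) : H \subset G -> [~: H, 'L_2(G)] = 1.
  by move=> sHG; apply/trivgP; rewrite /= commGC -L3;
    exact: (commgS 'L_2(G) sHG).
by rewrite !tr // normal_sub ?chi2_normal.
Qed.

(** For m >= 4 it suffices that the derived subgroup of M_i is not inside 'L_4(G). Otherwise x
    y^(i-2) would lie in chi_2(G), and so would x. *)
Lemma maxsub_lcn3 i : 2 <= i -> 'L_2(M i) = 'L_3(G).
Proof.
move=> i2; have sL: 'L_2(M i) \subset 'L_3(G).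
  apply: lcn2_gen_sub => [||a Aa]; rewrite ?lcn_normal ?maxsub_gen_in //.
  by rewrite -invg_comm groupV mem_commg_lcn ?maxsub_gen_in.
have [m4 | m_le3] := leqP 4 m; last first.
  apply/eqP; rewrite eqEsubset sL (maxclass_lcn_eq1 p_pr m_ge3 maxG) ?sub1G //.
have nMi : 'L_2(M i) <| G by rewrite (char_normal_trans (lcn_char 2 _))
  ?maxsub_normal.
apply: (@maxclass_normal_sub _ G p m p_pr m_ge3 maxG _ 3) nMi _ sL _; first
  by rewrite m4.
apply/negP=> sL4; have /setDP[_ /negP[]] := xP m4.
suff: x * y ^+ (i - 2) \in chi2 G.
  by rewrite groupMr ?groupX.
have := maxsub_gen i; rewrite gtn_eqF // => Mxy.
rewrite inE groupM ?groupX //; apply/forall_inP=> a Aa.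
by rewrite (subsetP sL4) // mem_commg // (subsetP (sub_lcn2_maxsub i)).
Qed.

Lemma expg_bin2_lcn3 u : odd p -> u \in 'L_2(G) -> u ^+ 'C(p, 2) \in 'L_3(G).
Proof.
move=> p_odd Au; have p3 : 2 < p by apply: odd_prime_gt2.
have /dvdnP[q ->] : p %| 'C(p, 2) by rewrite prime_dvd_bin.
by rewrite mulnC expgM groupX // (maxclass_lcn_expg p_pr m_ge3 maxG).
Qed.

(** * Values of the transfers at the generators *)

Variables (w z : nat).
Hypotheses (p_odd : odd p).
Hypothesis relx : x ^+ p = s m.-1 ^+ w.
Hypothesis rely : y ^+ p * \prod_(2 <= l < p.+1) s l ^+ 'C(p, l) = s m.-1 ^+ z.

Let V i g := FiniteModule.fmval (transfer G (ab_proj_abelian (M i)) g).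

Lemma maxsub_transfer_notin i g : g \in G -> g \notin M i ->
  V i g = coset 'L_2(M i) (g ^+ p).
Proof. exact: (transfer_notin (maxsub_normal i) p_pr (maxsub_index i)). Qed.

Lemma maxsub_transfer_in i g h : g \in M i -> h \in G -> h \notin M i ->
  V i g = \prod_(0 <= r < p) coset 'L_2(M i) g ^ (coset 'L_2(M i) h ^+ r).
Proof.
move=> Mg Gh M'h.
have nNG : G \subset 'N('L_2(M i)).
  by rewrite normal_norm // (char_normal_trans (lcn_char 2 _)) ?maxsub_normal.
have Nh := subsetP nNG h Gh.
have Ng := subsetP nNG g (subsetP (normal_sub (maxsub_normal i)) g Mg).
rewrite /V (transfer_in (maxsub_normal i) p_pr (maxsub_index i) Mg Gh M'h).
rewrite -[LHS]/(coset_morphism _ _) morph_prod; last first.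
  by move=> r _; rewrite groupJ ?groupX.
by apply: eq_bigr => r _; rewrite morphJ ?groupX // morphX.
Qed.

Lemma coset_lcn3_commute u g : u \in 'L_2(G) -> g \in G ->
  commute (coset 'L_3(G) u) (coset 'L_3(G) g).
Proof.
move=> Au Gg; have Gu := subsetP sAG u Au; have NL := subsetP (nL 3).
apply/commgP/eqP; rewrite -(morphR (coset_morphism 'L_3(G))) ?NL //=.
by rewrite coset_id // mem_commg_lcn.
Qed.

Lemma maxsub_transfer_x i : 1 <= i <= p.+1 -> V i x = coset 'L_2(M i)
  (s m.-1 ^+ w).
Proof.
case/andP=> i1 ip; have [i2 | i_neq2] := eqVneq i 2; last first.
  rewrite maxsub_transfer_notin ?relx //.
  case: i i1 ip i_neq2 => [|[|[|i]]] // _ ip _; first exact: x_notin_maxsub1.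
  by apply: x_notin_maxsub; rewrite ip.
rewrite i2 (maxsub_transfer_in x_in_maxsub2 Gy) ?y_notin_maxsub
  // maxsub_lcn3 //.
have NL := subsetP (nL 3).
have Axy : [~ x, y] \in 'L_2(G) by rewrite mem_commg.
(* Modulo 'L_3(G) the commutator [x, y] is central, so the sequence is trivial from index 2 on and
   only x^p [x, y]^C(p,2) survives. *)
pose t l := if l is 0 then coset 'L_3(G) x else
            if l is 1 then coset 'L_3(G) [~ x, y] else 1.
have tJ j : t j ^ coset 'L_3(G) y = t j * t j.+1.
  case: j => [|[|j]] /=; last by rewrite conj1g mulg1.
    by rewrite conjg_mulR -(morphR (coset_morphism 'L_3(G))) ?NL.
  by rewrite mulg1; apply/conjg_fixP/commgP/coset_lcn3_commute.
have tC j l : commute (t j) (t l).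
  have c1 : commute (coset 'L_3(G) [~ x, y]) (coset 'L_3(G) x).
    exact: coset_lcn3_commute.
  case: j => [|[|j]]; case: l => [|[|l]] //=; try exact: commute1;
    by [apply: commute_sym; apply: commute1 | apply: commute_sym].
rewrite (prod_conj_binomial tJ tC).
have p_gt2 := odd_prime_gt2 p_odd p_pr.
rewrite big_ltn ?prime_gt0 // big_ltn ?prime_gt1 // big_nat_cond big1 => [|l];
  last first.
  by case: l => [|[|l]] //; rewrite /t expg1n.
have Gxy := subsetP sAG _ Axy.
rewrite /t bin1 mulg1 -!(morphX (coset_morphism 'L_3(G))) ?NL //=.
by rewrite relx (coset_id (expg_bin2_lcn3 p_odd Axy)) mulg1.
Qed.

Lemma maxsub_transfer_y i : 1 <= i <= p.+1 -> V i y = coset 'L_2(M i)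
  (s m.-1 ^+ z).
Proof.
case/andP=> i1 ip; have [i_eq1 | i_neq1] := eqVneq i 1%N; last first.
  have i2 : 2 <= i by case: i i1 i_neq1 {ip} => [|[]].
  rewrite maxsub_transfer_notin ?y_notin_maxsub // maxsub_lcn3 // -rely.
  set P := (\prod_(2 <= l < p.+1) _); have NL := subsetP (nL 3).
  (* Only the factor l = 2 is not in 'L_3(G) by its index; its exponent C(p,2) is a multiple of
     p. *)
  have LP : P \in 'L_3(G).
    rewrite /P big_nat_cond group_prod // => l /andP[/andP[l2 _] _].
    have [-> | l_neq2] := eqVneq l 2; first
      by rewrite expg_bin2_lcn3 ?scomm_lcn.
    have l3 : 2 < l by rewrite ltn_neqAle eq_sym l_neq2.
    by rewrite groupX // (subsetP (lcn_sub_leq G l3)) ?scomm_lcn.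
  have GP := subsetP (lcn_sub 3 G) P LP.
  by rewrite [RHS](morphM (coset_morphism 'L_3(G))) ?NL ?groupX //=
    (coset_id LP) mulg1.
have M1y : y \in M 1%N := maxsub_gen 1%N.
rewrite i_eq1 (maxsub_transfer_in M1y Gx x_notin_maxsub1).
set N := 'L_2(M 1%N).
have nNG : G \subset 'N(N).
  by rewrite normal_norm // (char_normal_trans (lcn_char 2 _)) ?maxsub_normal.
have NG := subsetP nNG; have Gs l : s l.+2 \in G
  by rewrite (subsetP (lcn_sub l.+2 G)) ?scomm_lcn.
(* The sequence y, s_2, s_3, ...: commuting a term with x gives the next one. *)
pose u l := if l is l'.+1 then s l'.+2 else y.
have Gu l : u l \in G by case: l.
pose t l := coset N (u l).
have tJ j : t j ^ coset N x = t j * t j.+1.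
  case: j => [|j]; rewrite /t /= conjg_mulR -(morphR (coset_morphism N)) ?NG //.
  by rewrite scommS.
have tM j : t j \in M 1%N / N.
  apply: mem_quotient; case: j => [|j] //.
  by rewrite (subsetP (sub_lcn2_maxsub 1%N)) //
    (subsetP (@lcn_sub_leq _ j.+2 2 G isT)) ?scomm_lcn.
have tC j l : commute (t j) (t l).
  have /centsP cM : abelian (M 1%N / N) by apply: sub_der1_abelian.
  exact: cM.
rewrite -[coset N y]/(t 0%N) (prod_conj_binomial tJ tC).
have -> : \prod_(0 <= l < p) t l ^+ 'C(p, l.+1)
        = coset N (\prod_(0 <= l < p) u l ^+ 'C(p, l.+1)).
  rewrite -[RHS]/(coset_morphism N _) morph_prod => [|l _]; last
    by rewrite NG ?groupX.
  by apply: eq_bigr => l _; rewrite morphX ?NG.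
by rewrite big_ltn ?prime_gt0 // bin1 -rely !big_add1.
Qed.

Lemma maxsub_transferX i g n : g \in G -> V i (g ^+ n) = V i g ^+ n.
Proof.
move=> Gg; rewrite /V; elim: n => [|n IHn].
  by rewrite !expg0 [transfer _ _ _](morph1 (transfer_morphism G
    (ab_proj_abelian (M i)))).
by rewrite [RHS]expgS -IHn expgS transferM ?groupX.
Qed.

Lemma ab_transfer_maxsub i j l : 1 <= i <= p.+1 ->
  ab_transfer G (M i) (coset 'L_2(G) (x ^+ j * y ^+ l))
  = coset 'L_2(M i) (s m.-1 ^+ (w * j + z * l)).
Proof.
move=> i_range; rewrite ab_transferE ?groupM ?groupX // transferM ?groupX //.
rewrite -[LHS]/(V i (x ^+ j) * V i (y ^+ l)) !maxsub_transferX
  // maxsub_transfer_x // maxsub_transfer_y //.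
have Gs : s m.-1 \in 'N('L_2(M i)).
  have nN : G \subset 'N('L_2(M i)).
    by rewrite normal_norm // (char_normal_trans (lcn_char 2 _)) ?maxsub_normal.
  rewrite (subsetP nN) // (subsetP (lcn_sub m.-1 G)) ?scomm_lcn //.
  by case: m m_ge3 => [|[]].
rewrite expgD !expgM [RHS](morphM (coset_morphism _)) ?groupX //.
by rewrite !(morphX (coset_morphism _)) ?groupX.
Qed.

(** * The position of [chi_2(G), 'L_2(G)] in the lower central series *)

(** The right hand side contains [y, x] and is normal, because its commutators with G lie in
    'L_3(G). *)
Lemma lcn2_cycle_mul : 'L_2(G) = <[s 2]> * 'L_3(G).
Proof.
have As : s 2 \in 'L_2(G) := @scomm_lcn 2 isT.
have sCA : <[s 2]> \subset 'L_2(G) by rewrite cycle_subG.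
have nL3 : <[s 2]> \subset 'N('L_3(G))
  by rewrite (subset_trans (subset_trans sCA sAG)).
apply/eqP; rewrite -norm_joinEl // eqEsubset join_subG sCA lcn_subS !andbT.
apply: (lcn2_sub_gen2 genG); last by rewrite mem_gen // inE cycle_id.
have sJA : <[s 2]> <*> 'L_3(G) \subset 'L_2(G)
  by rewrite join_subG sCA lcn_subS.
rewrite /normal (subset_trans sJA sAG) -commg_subl.
exact: subset_trans (commSg G sJA) (joing_subr _ _).
Qed.

(** For j = 2 this is the definition of chi_2(G); [commg_AC] propagates it, moving the commutator
    with h past the one with v. *)
Lemma lcn_chi2_comm j u g : 2 <= j -> u \in 'L_j(G) -> g \in chi2 G ->
  [~ u, g] \in 'L_j.+2(G).
Proof.
case: j => [|[|j]] // _; elim: j u g => [|j IHj] u g Lu Cg;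
  first exact: chi2_comm.
have Gg := subsetP (normal_sub chi2_normal) g Cg.
suff /subsetP/(_ u Lu) : 'L_j.+3(G) \subset cent_mod G
  (chi2_group G) 'L_(j.+4.+1)(G)%G.
  by case/(cent_modP (lcn_normal _ _) chi2_normal)=> _ /(_ g Cg).
rewrite lcnSn gen_subG; apply/subsetP=> _ /imset2P[b h Lb Gh ->].
have Ab := subsetP (@lcn_sub_leq _ j.+2 2 G isT) b Lb.
apply/(cent_modP (lcn_normal _ _) chi2_normal); split=> [|v Cv].
  by rewrite groupR // (subsetP sAG).
rewrite (commg_AC metaG) // ?(subsetP (normal_sub chi2_normal)) //.
by apply: mem_commg_lcn => //; apply: IHj.
Qed.

Lemma rely3 : p = 3 -> y ^+ 3 * (s 2 ^+ 3 * s 3) = s m.-1 ^+ z.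
Proof. by move: rely => + p3; rewrite p3 2?big_ltn // big_geq // mulg1. Qed.

(** The left hand side of the second relation commutes with x. Modulo 'L_4(G) its commutator with x
    reduces to [y^3, x] = s_2^3, since y commutes with s_2 there and s_3^3 and s_4 vanish. *)
Lemma scomm2_cube : p = 3 -> s 2 ^+ 3 \in 'L_4(G).
Proof.
move=> p3; have NL := subsetP (nL 4).
have As2 : s 2 \in 'L_2(G) := @scomm_lcn 2 isT.
have Ls3 : s 3 \in 'L_3(G) := @scomm_lcn 3 isT.
have Gs2 := subsetP sAG _ As2; have Gs3 := subsetP (lcn_sub 3 G) _ Ls3.
have As3 : s 3 \in 'L_2(G) by rewrite (subsetP (lcn_subS 2 G)).
have R1 : [~ y ^+ 3 * (s 2 ^+ 3 * s 3), x] = 1.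
  rewrite (rely3 p3) lcn_last_central ?groupX ?scomm_lcn //.
  by case: m m_ge3 => [|[]].
pose f := coset_morphism 'L_4(G).
have fR g h : g \in G -> h \in G -> f [~ g, h] = [~ f g, f h].
  by move=> Gg Gh; rewrite morphR ?NL.
have f1 g : g \in 'L_4(G) -> f g = 1 by apply: coset_id.
have cy : commute (f y) [~ f y, f x].
  rewrite -fR //; apply/commute_sym/commgP/eqP; rewrite -fR //.
  by rewrite f1 // chi2_comm.
have c23 : commute (f (s 2)) [~ f (s 2), f x].
  rewrite -fR // -scommS; apply/commgP/eqP; rewrite -fR //.
  by have /commgP/eqP-> := cA As2 As3; rewrite f1.
have Gy3 : y ^+ 3 \in G by apply: groupX.
have Gs23 : s 2 ^+ 3 \in G by apply: groupX.
have fM g h : g \in G -> h \in G -> f (g * h) = f g * f h.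
  by move=> Gg Gh; rewrite morphM ?NL.
have fX g : g \in G -> f (g ^+ 3) = f g ^+ 3 by move=> Gg; rewrite morphX ?NL.
have s33 : s 3 ^+ 3 \in 'L_4(G).
  by have := @maxclass_lcn_expg _ G p m p_pr m_ge3 maxG 3 _ isT Ls3; rewrite p3.
have: f [~ y ^+ 3 * (s 2 ^+ 3 * s 3), x] = 1 by rewrite R1 morph1.
rewrite (fR _ _ (groupM Gy3 (groupM Gs23 Gs3)) Gx) (fM _ _ Gy3
  (groupM Gs23 Gs3)).
rewrite commMgJ (fX y) // (commXg _ cy) -(fR y) // -(fX (s 2)) //.
rewrite (fM _ _ Gs23 Gs3) commMgJ (fX (s 2)) // (commXg _ c23) -(fR (s 2))
  // -(fR (s 3)) //.
rewrite -!scommS -(fX (s 3)) // (f1 _ s33) (f1 (s 4)) ?(@scomm_lcn 4) // conj1g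
  !mulg1.
move/eqP; rewrite conjg_eq1 -(fX (s 2)) // => /eqP f3.
exact: coset_idr (NL _ Gs23) f3.
Qed.

(** Cubes may be tested on generators since 'L_2(G) is abelian. The base case is [scomm2_cube], and
    the induction uses [b, h]^3 = [b^3, h]. *)
Lemma lcn_cube j u : p = 3 -> 2 <= j -> u \in 'L_j(G) -> u ^+ 3 \in 'L_j.+2(G).
Proof.
move=> p3; case: j => [|[|j]] // _; elim: j u => [|j IHj] u.
  rewrite lcn2_cycle_mul => /mulsgP[_ b /cycleP[i ->] Lb ->].
  have As2 : s 2 ^+ i \in 'L_2(G) by rewrite groupX ?scomm_lcn.
  rewrite expgMn; last by apply: cA As2 _; rewrite (subsetP (lcn_subS 2 G)).
  have -> : (s 2 ^+ i) ^+ 3 = (s 2 ^+ 3) ^+ i by rewrite -!expgM mulnC.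
  rewrite groupM //; first by rewrite groupX ?scomm2_cube.
  by have := @maxclass_lcn_expg _ G p m p_pr m_ge3 maxG 3 _ isT Lb; rewrite p3.
pose K := [set a in 'L_2(G) | a ^+ 3 \in 'L_(j.+4.+1)(G)].
have gK : group_set K.
  apply/group_setP; split=> [|a b]; first by rewrite inE expg1n !group1.
  rewrite !inE => /andP[Aa a3] /andP[Ab b3].
  by rewrite groupM // (expgMn 3 (cA Aa Ab)) groupM.
suff: 'L_j.+3(G) \subset Group gK by move/subsetP=> sLK /sLK;
  rewrite inE => /andP[].
rewrite lcnSn gen_subG; apply/subsetP=> _ /imset2P[b h Lb Gh ->].
have Ab := subsetP (@lcn_sub_leq _ j.+2 2 G isT) b Lb.
have Abh : [~ b, h] \in 'L_2(G)
  by rewrite (subsetP (@lcn_sub_leq _ j.+3 2 G isT)) ?mem_commg_lcn.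
by rewrite inE Abh -commXg ?mem_commg_lcn ?IHj //; apply: cA.
Qed.

Lemma chi2_comm_lcn_p3 j : p = 3 -> 4 <= j -> j.+2 <= m ->
  [~: chi2 G, 'L_2(G)] <> 'L_j(G).
Proof.
move=> p3 j4 jm BL; have m4 : 4 <= m by rewrite (leq_trans j4) // ltnW // ltnW.
have nsC := chi2_normal.
pose Q := 'L_j.+2(G)%G; have nQ : Q <| G := lcn_normal _ _.
(* D is the preimage of the centre of G / 'L_(j+2)(G), and K collects the elements whose commutators
   with chi_2(G) lie in D. The aim is 'L_2(G) inside K, for which s_2 in K suffices. *)
pose D := cent_mod_group G G Q;
  have nD : D <| G := cent_mod_normal nQ (normal_refl G).
pose K := cent_mod_group G (chi2_group G) D.
have nK : K <| G := cent_mod_normal nD nsC.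
have As2 : s 2 \in 'L_2(G) := @scomm_lcn 2 isT.
have Ls3 : s 3 \in 'L_3(G) := @scomm_lcn 3 isT.
have As3 : s 3 \in 'L_2(G) by rewrite (subsetP (lcn_subS 2 G)).
have Gs2 := subsetP sAG _ As2.
pose c := [~ s 2, y].
have Lc : c \in 'L_j(G) by rewrite -BL /c -(invg_comm y (s 2)) groupV mem_commg.
have Ac : c \in 'L_2(G).
  by rewrite (subsetP (@lcn_sub_leq _ j 2 G _)) // (leq_trans _ j4).
(* Commute the second relation with y: the factor y^3 drops out and s_2^3 contributes c^3. *)
have s3y : [~ s 3, y] = c ^- 3.
  have: [~ y ^+ 3 * (s 2 ^+ 3 * s 3), y] = 1.
    rewrite (rely3 p3) lcn_last_central ?groupX ?scomm_lcn //.
    by case: m m_ge3 => [|[]].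
  have y3 : [~ y ^+ 3, y] = 1.
    by apply/eqP/commgP/commute_sym/commuteX/commute_refl.
  rewrite commMgJ y3 conj1g mul1g commMgJ (commXg 3 (cA As2 Ac)) -/c.
  rewrite (conjg_fixP _); last by apply/commgP/cA; rewrite ?groupX.
  by move/eqP; rewrite mulg_eq1 => /eqP->; rewrite invgK.
(* Here [c, x] = [s_3, y] = c^-3 lies in 'L_(j+2)(G) by [lcn_cube], and [c, y] does because y is in
   chi_2(G). *)
have Dc : c \in D.
  apply: (cent_mod_gen2 genG nQ); first exact: (subsetP sAG).
    rewrite (commg_AC metaG As2) // -scommS s3y groupV.
    by apply: lcn_cube => //; rewrite (leq_trans _ j4).
  by apply: lcn_chi2_comm => //; rewrite (leq_trans _ j4).
have Ks2 : s 2 \in K.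
  apply/(cent_modP nD nsC); split=> // u Cu.
  have ND := normal_norm nD.
  suff /subsetP: [~: <<[set s 2]>>, <<y |: 'L_2(G)>>] \subset D.
    apply; apply: mem_commg; first by rewrite mem_gen ?set11.
    by move: Cu; rewrite /= chi2_maxsub1.
  apply: commg_gen_sub; first by rewrite sub1set (subsetP ND).
    by rewrite subUset sub1set (subsetP ND) // (subset_trans sAG).
  move=> _ b /set1P-> /setU1P[->|Ab] //.
  by have /commgP/eqP-> := cA As2 Ab; rewrite group1.
have sAK : 'L_2(G) \subset K by apply: (lcn2_sub_gen2 genG).
have sBD : 'L_j(G) \subset D.
  rewrite -BL gen_subG; apply/subsetP=> _ /imset2P[g a Cg Aa ->].
  have /(cent_modP nD nsC)[_ /(_ g Cg)] := subsetP sAK a Aa.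
  by move=> Dag; rewrite -invg_comm groupV.
have: 'L_j.+1(G) \subset 'L_j.+2(G).
  have -> : 'L_j.+1(G) = [~: 'L_j(G), G] by case: (j) j4.
  rewrite gen_subG; apply/subsetP=> _ /imset2P[u g Lu Gg ->].
  have Du : u \in D by rewrite (subsetP sBD).
  by case/(cent_modP nQ (normal_refl G)): Du => _ /(_ g Gg).
apply/negP; have := maxclass_lcn_proper p_pr m_ge3 maxG (j := j.+1).
by rewrite jm properE => /(_ isT)/andP[].
Qed.

Lemma chi2_comm_lcn : 4 <= m ->
  exists2 j, 4 <= j <= m & [~: chi2 G, 'L_2(G)] = 'L_j(G).
Proof.
move=> m4; pose B := [~: chi2 G, 'L_2(G)]%G.
have nB : B <| G.
  have := char_normal_trans (lcn_char 2 _) (maxsub_normal 1%N).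
  by rewrite /normal /= -/(M 1%N) lcn2_maxsub1.
have sB4 : B \subset 'L_4(G).
  rewrite gen_subG; apply/subsetP=> _ /imset2P[g a Cg Aa ->].
  by rewrite -invg_comm groupV chi2_comm.
have [B1 | ntB] := eqVneq (B : {set gT}) 1.
  exists m; first by rewrite m4 leqnn.
  exact: etrans B1 (esym (maxclass_lcn_eq1 p_pr m_ge3 maxG (leqnn m))).
have bnd j : B \subset 'L_j(G) -> j <= m.
  rewrite leqNgt => sBj; apply: contra ntB => /ltnW lemj.
  by rewrite -subG1 -(maxclass_lcn_eq1 p_pr m_ge3 maxG lemj).
(* Take the last term of the series that contains B. *)
case: (ex_maxnP (ex_intro _ 4 sB4) bnd) => j sBj maxj.
have j4 := maxj 4 sB4; have jm := bnd j sBj.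
exists j; first by rewrite j4.
have [jm'|] := ltnP j m; last first.
  move=> mj; case/eqP: ntB; apply/trivgP.
  by rewrite -(maxclass_lcn_eq1 p_pr m_ge3 maxG mj).
apply: (maxclass_normal_sub p_pr m_ge3 maxG nB _ sBj).
  by rewrite jm' (leq_trans _ j4).
by apply/negP=> /maxj; rewrite ltnn.
Qed.

(** A witness k below m keeps [find] from its default value m, and [find] returns the least
    solution. *)
Lemma invariant_k_min k : k < m -> [~: chi2 G, 'L_2(G)] = 'L_(m - k)(G) ->
  invariant_k m G <= k
  /\ [~: chi2 G, 'L_2(G)] = 'L_(m - invariant_k m G)(G).
Proof.
move=> ltkm Bk; pose P i := [~: chi2 G, 'L_2(G)] == 'L_(m - i)(G).
have lek : invariant_k m G <= k.
  rewrite leqNgt; apply/negP=> /(before_find 0).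
  by rewrite nth_iota // add0n -Bk eqxx.
split=> //; have hasP : has P (iota 0 m).
  by rewrite has_find size_iota (leq_ltn_trans lek).
have /eqP := nth_find 0 hasP.
by rewrite nth_iota ?add0n // (leq_ltn_trans lek).
Qed.

Lemma chi2_comm_cases :
  [\/ [/\ [~: chi2 G, 'L_2(G)] = 1, invariant_k m G = 0%N, 3 <= m & 3 <= p],
      [/\ [~: chi2 G, 'L_2(G)] = 'L_m.-1(G), invariant_k m G = 1%N, 5 <= m & 3 <= p]
    | [/\ [~: chi2 G, 'L_2(G)] = 'L_(m - invariant_k m G)(G),
          2 <= invariant_k m G, 6 <= m & 5 <= p]].
Proof.
have p_gt2 := odd_prime_gt2 p_odd p_pr.
have Lm1 : 'L_m(G) = 1 by apply: (maxclass_lcn_eq1 p_pr m_ge3 maxG).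
have [m_le3 | m4] := ltnP m 4.
  have L3 : 'L_3(G) = 1 by apply: (maxclass_lcn_eq1 p_pr m_ge3 maxG).
  have B1 : [~: chi2 G, 'L_2(G)] = 1.
    apply/trivgP; rewrite /= commGC -L3.
    exact: (commgS 'L_2(G) (normal_sub chi2_normal)).
  have Bk : [~: chi2 G, 'L_2(G)] = 'L_(m - 0)(G) by rewrite subn0 B1 Lm1.
  have [lek _] := invariant_k_min (ltn_trans (ltn0Sn _) m_ge3) Bk.
  by constructor 1; split=> //; apply/eqP; rewrite -leqn0.
have [j /andP[j4 jm] Bj] := chi2_comm_lcn m4.
have [||lek Bk] := @invariant_k_min (m - j).
- by rewrite ltn_subrL (leq_trans _ j4) ?(leq_trans _ m4).
- by rewrite subKn.
(* This comes from j >= 4, and gives m >= 5 for k = 1 and m >= 6 for k >= 2. *)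
have le_k4 : invariant_k m G + 4 <= m.
  by apply: leq_trans (leq_add lek j4) _; rewrite subnK.
case Ek: (invariant_k m G) le_k4 Bk => [|[|k]] le_k4 Bk.
- by constructor 1; rewrite Bk subn0.
- by constructor 2; rewrite Bk subn1.
have km : k.+2 <= m by apply: leq_trans (leq_addr 4 _) le_k4.
constructor 3; split=> //.
  by apply: leq_trans le_k4; rewrite -[6]/(2 + 4)%N leq_add2r.
have: p != 3.
  apply/eqP=> p3; case: (@chi2_comm_lcn_p3 (m - k.+2) p3 _ _ Bk).
    by rewrite leq_subRL.
  by rewrite -addn2 addnC -leq_subRL ?leq_sub2l // ltnW.
by case: p p_gt2 p_odd => [|[|[|[|[|]]]]].
Qed.

End MetabelianMaximalClass.

Unset Implicit Arguments.
Set Strict Implicit.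
Set Printing Implicit Defensive.

Theorem theorem2p2 (p m : nat) (gT : finGroupType) (G : {group gT})
    (x y : gT) (w z : nat)
    (p_prime : prime p) (p_odd : odd p) (m_ge3 : 3 <= m)
    (maxG : maximal_class p m G) (metaG : metabelian G)
    (genG : <<[set x; y]>> = G)
    (xP : 4 <= m -> x \in G :\: chi2 G)
    (yP : y \in chi2 G :\: 'L_2(G))
    (w_lt : w < p) (z_lt : z < p)
    (relx : x ^+ p = scomm x y m.-1 ^+ w)
    (rely : y ^+ p * \prod_(2 <= l < p.+1) scomm x y l ^+ 'C(p, l)
            = scomm x y m.-1 ^+ z) :
  let M := maxsub G x y in
  let V i := ab_transfer G (M i) in
  let k := invariant_k m G in
  let s := scomm x y in
  (* exhaustiveness of the three cases for V_1 below *)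
  [\/ [/\ [~: chi2 G, 'L_2(G)] = 1, k = 0%N, 3 <= m & 3 <= p],
      [/\ [~: chi2 G, 'L_2(G)] = 'L_(m.-1)(G), k = 1%N, 5 <= m & 3 <= p]
    | [/\ [~: chi2 G, 'L_2(G)] = 'L_(m - k)(G), 2 <= k, 6 <= m & 5 <= p]]
  /\
  forall j l : nat, j < p -> l < p ->
    let u := coset 'L_2(G) (x ^+ j * y ^+ l) in
    let e := (w * j + z * l)%N in
    [/\ (* the uniform formula *)
        forall i : nat, 1 <= i <= p.+1 ->
          V i u = s m.-1 ^+ e *: 'L_2(M i) :> {set gT},
        (* the explicit form for i = 1 *)
        [/\ [/\ [~: chi2 G, 'L_2(G)] = 1, k = 0%N, 3 <= m & 3 <= p] ->
              V 1%N u = s m.-1 ^+ e *: [1 gT] :> {set gT},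
            [/\ [~: chi2 G, 'L_2(G)] = 'L_(m.-1)(G), k = 1%N, 5 <= m & 3 <= p] ->
              V 1%N u = 1 *: 'L_(m.-1)(G) :> {set gT}
          & [/\ [~: chi2 G, 'L_2(G)] = 'L_(m - k)(G), 2 <= k, 6 <= m & 5 <= p] ->
              V 1%N u = 1 *: 'L_(m - k)(G) :> {set gT}]
      & (* the explicit form for 2 <= i <= p + 1 *)
        forall i : nat, 2 <= i <= p.+1 ->
          (m = 3 -> V i u = s 2 ^+ e *: [1 gT] :> {set gT})
          /\ (4 <= m -> V i u = 1 *: 'L_3(G) :> {set gT})].
Proof.
move=> M V k s; split.
  exact: (chi2_comm_cases p_prime m_ge3 maxG metaG genG xP yP p_odd rely).
move=> j l _ _ u e.
have Lsm : s m.-1 ^+ e \in 'L_m.-1(G).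
  rewrite groupX // (scomm_lcn genG) //.
  by case: (m) m_ge3 => [|[]].
have Vu i : 1 <= i <= p.+1 -> V i u = s m.-1 ^+ e *: 'L_2(M i) :> {set gT}.
  move=> i_range; rewrite /V.
  rewrite (ab_transfer_maxsub p_prime m_ge3 maxG metaG genG xP yP p_odd relx rely) //.
  have Ns : s m.-1 ^+ e \in 'N('L_2(M i)).
    have /andP[_ nMG] := char_normal_trans (lcn_char 2 _)
      (maxsub_normal genG i).
    exact: (subsetP nMG) (subsetP (lcn_sub m.-1 G) _ Lsm).
  by rewrite val_coset // norm_rlcoset.
(* The power of s_(m-1) lies in 'L_(m-1)(G), hence in every earlier term, so its coset is
   trivial. *)
have lcn_absorb i : i <= m.-1 -> s m.-1 ^+ e *: 'L_i(G) = 1 *: 'L_i(G).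
  by move=> im; rewrite !lcoset_id // (subsetP (lcn_sub_leq G im)).
have V1 B : [~: chi2 G, 'L_2(G)] = B -> V 1%N u = s m.-1 ^+ e *: B :> {set gT}.
  by move=> <-; rewrite Vu //
    (lcn2_maxsub1 p_prime m_ge3 maxG metaG genG xP yP).
split=> //.
  split=> -[B_eq].
  - by move=> *; apply: V1.
  - by move=> *; rewrite (V1 _ B_eq) lcn_absorb.
  - move=> k2 *; rewrite (V1 _ B_eq) lcn_absorb // -subn1 leq_sub2l //.
    exact: ltnW.
move=> i /andP[i2 ip].
have Vi : V i u = s m.-1 ^+ e *: 'L_3(G) :> {set gT}.
  rewrite Vu ?(ltnW i2) //.
  by rewrite (maxsub_lcn3 p_prime m_ge3 maxG metaG genG xP yP).
split=> [m3 | m4]; last by rewrite Vi lcn_absorb // -ltnS prednK //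
  (ltn_trans _ m4).
by rewrite Vi (maxclass_lcn_eq1 p_prime m_ge3 maxG) m3.
Qed.
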